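(* In an irreducible Markov renewal process on a finite state space $S=\{1,\dots,m\}$, with embedded chain transition matrix $P$ and stationary distribution $\{\pi_j\}$ of the embedded chain, mean sojourn time vector $\mu$, $\lambda=\pi^T\mu>0$, and mean first passage times $m_{ij}$, the mixture $k_i^{(1)}=\sum_{j\in S}\pi_jm_{ij}$ is independent of the initial state $i$ if and only if the mean sojourn times $\mu_j$ are the same for all states $j$. When this condition is satisfied, i.e. $\mu=\lambda e$, one has $k^{(1)}_i=K_C^{(1)}$ for all $i$, where $$K_C^{(1)}=\lambda\left[1+\mathrm{tr}(G)-\mathrm{tr}(G\Pi)\right]=\lambda\,\mathrm{tr}(Z)=\lambda\left[1+\mathrm{tr}(A^{\#})\right]=\lambda\left[1+\mathrm{tr}(\widetilde G)\right]-\frac{1}{u^Te},$$ for any g-inverse $G$ of $I-P$, $Z=[I-P+\Pi]^{-1}$, $A^{\#}$ the group inverse of $I-P$, and $\widetilde G=[I-P+\mu u^T]^{-1}$ for any $u\in\mathbb{R}^m$ with $u^Te\neq0$.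
   Context: A Markov renewal process (MRP) $\{(X_n,T_n),n\ge 0\}$ on $S=\{1,\dots,m\}$ has $T_0=0\le T_1\le T_2\le\cdots$ and semi-Markov kernel $Q_{ij}(t)=P\{X_{n+1}=j,\ T_{n+1}-T_n\le t\mid X_n=i\}$ (Markov property: conditionally on the past up to step $n$, the law of $(X_{n+1},T_{n+1}-T_n)$ depends only on $X_n$, through this kernel). The embedded Markov chain $\{X_n\}$ has transition matrix $P=[p_{ij}]$, $p_{ij}=Q_{ij}(+\infty)$; the MRP is called irreducible when $P$ is irreducible. Put $\mu_{ij}=\int_0^\infty t\,dQ_{ij}(t)$, assumed finite, and $\mu_i=\sum_k\mu_{ik}$, the mean sojourn time on a visit to state $i$; $\mu=(\mu_1,\dots,\mu_m)^T$. $\pi=(\pi_1,\dots,\pi_m)^T$ is the unique vector with $\pi^TP=\pi^T$, $\pi^Te=1$, where $e=(1,\dots,1)^T$; $\Pi=e\pi^T$. $\lambda=\pi^T\mu$, assumed positive. The mean first passage time is $m_{ij}=E[T_{ij}\mid X_0=i]$, where $T_{ij}=T_n$ with $n=\min\{r\ge1: X_r=j\}$ given $X_0=i$ (the return time if $i=j$); these are all finite. A g-inverse (one-condition generalized inverse) of $I-P$ is any matrix $G$ with $(I-P)G(I-P)=I-P$. The group inverse $A^{\#}$ of $A=I-P$ is the unique matrix with $AA^{\#}A=A$, $A^{\#}AA^{\#}=A^{\#}$, $AA^{\#}=A^{\#}A$; it equals $Z-\Pi$. *)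

(* Defs.v *)
From HB Require Import structures.
From mathcomp Require Import all_boot all_order all_algebra.
From mathcomp Require Import all_classical all_reals all_analysis.

Set Implicit Arguments.
Unset Strict Implicit.
Unset Printing Implicit Defensive.

Import Order.TTheory GRing.Theory Num.Theory.
Import numFieldNormedType.Exports.

Local Open Scope classical_set_scope.
Local Open Scope ring_scope.

Section MarkovRenewal.
Context {d : measure_display} {Omega : measurableType d} {R : realType}.
Variable m : nat.
Implicit Types (Pr : probability Omega R) (Q : 'I_m -> 'I_m -> cumulative R R).
Implicit Types (X : nat -> Omega -> 'I_m) (T : nat -> Omega -> R).

Definition history X T (n : nat) : set (set Omega) :=
  <<s [set A | exists2 k : nat, (k <= n)%N &
         (exists j : 'I_m, A = X k @^-1` [set j]) \/
         (exists2 B : set R, measurable B & A = T k @^-1` B)] >>.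

(** [mrp_markov] is the Markov property P(X_{n+1} = j, T_{n+1} - T_n <= t | F_n)
    = Q_{X_n, j}(t) in integrated form, i.e. tested on A `&` {X_n = i} for every
    A in F_n.  With A = Omega it is Q_ij(t) = P(... | X_n = i). *)
Record markov_renewal Pr Q X T : Prop := MarkovRenewal {
  mrp_measX : forall n j, measurable (X n @^-1` [set j]);
  mrp_measT : forall n, measurable_fun setT (T n);
  mrp_T0 : forall w, T 0%N w = 0;
  mrp_Tle : forall n w, T n w <= T n.+1 w;
  mrp_markov : forall (n : nat) (i j : 'I_m) (t : R) (A : set Omega),
    history X T n A ->
    Pr (A `&` [set w | [/\ X n w = i, X n.+1 w = j & T n.+1 w - T n w <= t]])
    = ((Q i j t)%:E * Pr (A `&` [set w | X n w = i]))%E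
}.

(** The laws of the process "given X_0 = i": a family of probabilities [Pr i]
    under which (X, T) is a Markov renewal process with the same kernel [Q],
    started at [i]. *)
Definition mrp_family (Pr : 'I_m -> probability Omega R) Q X T : Prop :=
  forall i, markov_renewal (Pr i) Q X T /\ Pr i [set w | X 0%N w = i] = 1%E.

Definition embedded_mx Q : 'M[R]_m :=
  \matrix_(i, j) lim (Q i j t @[t --> +oo]).

Definition irreducible_mx (P : 'M[R]_m) : Prop :=
  forall i j, exists n : nat, 0 < (P ^+ n) i j.

Definition mean_transition_time Q (i j : 'I_m) : \bar R :=
  (\int[lebesgue_stieltjes_measure (Q i j)]_(t in `[0%R, +oo[) t%:E)%E.

Definition mean_sojourn Q : 'cV[R]_m :=
  \col_i \sum_k fine (mean_transition_time Q i k).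

(** T_n for n = min {r >= 1 : X_r = j}, and +oo if [j] is never reached. *)
Definition first_passage_time X T (j : 'I_m) (w : Omega) : \bar R :=
  match pselect (exists r : nat, (0 < r)%N && (X r w == j)) with
  | left ex_r => (T (ex_minn ex_r) w)%:E
  | right _ => +oo%E
  end.

Definition mean_first_passage (Pr : 'I_m -> probability Omega R) X T
    (i j : 'I_m) : \bar R :=
  (\int[Pr i]_w first_passage_time X T j w)%E.

Definition mixed_first_passage (Pr : 'I_m -> probability Omega R) X T
    (pi : 'cV[R]_m) (i : 'I_m) : \bar R :=
  (\sum_(j < m) (pi j 0)%:E * mean_first_passage Pr X T i j)%E.

End MarkovRenewal.

Definition ones {R : realType} {m : nat} : 'cV[R]_m := const_mx 1.

Definition is_ginv {R : realType} {m : nat} (A G : 'M[R]_m) : Prop :=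
  A *m G *m A = A.

Definition is_group_inverse {R : realType} {m : nat} (A X : 'M[R]_m) : Prop :=
  [/\ A *m X *m A = A, X *m A *m X = X & A *m X = X *m A].

(* Main.v *)
(** The proof rests on the fact that m_ij solves the one-step equations.
    Let N_j be P with its j-th column replaced by zero.  Since T_{n+1} - T_n,
    given the past, depends only on X_n, summing the sojourn times over the
    steps at which j has not yet been visited gives m_ij as the i-th entry of
    the series sum_n N_j^n mu, whose sum is (I - N_j)^-1 mu; convergence and
    invertibility both come from the minimum principle for superharmonic
    functions of an irreducible chain.  Hence, with D = diag(m_jj),
    (I - P)(M - D) = mu e^T - D.  Multiplying by pi^T on the left gives
    D pi = lambda e, so that (I - P)(M pi) = mu - lambda e, and M pi is constant
    exactly when mu = lambda e because the kernel of I - P is spanned by e.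
    In that case, multiplying the equation by Z on the left and by diag(pi) on
    the right and taking traces yields the constant lambda tr Z; the other
    expressions follow from (I - P) Z = I - Pi. *)
Require Import Defs.
From HB Require Import structures.
From mathcomp Require Import all_boot all_order all_algebra.
From mathcomp Require Import all_classical all_reals all_analysis.
From mathcomp Require Import measurable_realfun ring lra.

Set Implicit Arguments.
Unset Strict Implicit.
Unset Printing Implicit Defensive.

Import Order.TTheory GRing.Theory Num.Theory.
Import numFieldNormedType.Exports.

Local Open Scope classical_set_scope.
Local Open Scope ring_scope.

(** * Irreducible stochastic matrices *)

Lemma unitmx_trivial_kernel (F : fieldType) m (A : 'M[F]_m) :
  (forall x : 'cV_m, A *m x = 0 -> x = 0) -> A \in unitmx.
Proof.
move=> kerA; rewrite unitmxE unitfE -det_tr; apply/det0P => -[v v0 vA].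
suff /eqP : v^T = 0 by rewrite -trmx0 (inj_eq (can_inj (@trmxK _ _ _))) (negPf v0).
by apply: kerA; rewrite -[A]trmxK -trmx_mul vA trmx0.
Qed.

(** Commutation makes the two projections agree, [A X = A Y A X = Y A X A = Y A = A Y]; then
    [X = X A X] can be turned into [Y A Y] one factor at a time. *)
Lemma group_inverse_unique (R : realType) m (A X Y : 'M[R]_m) :
  is_group_inverse A X -> is_group_inverse A Y -> X = Y.
Proof.
move=> [AXA XAX AX] [AYA YAY AY].
have AXY : A *m X = A *m Y.
  by rewrite -{1}AYA AY -!mulmxA AX (mulmxA A) AXA -AY.
by rewrite -XAX -mulmxA AXY mulmxA -AX AXY AY YAY.
Qed.

(** By induction on [n], row [i] of [P ^+ n] vanishes outside [C], so no state outside [C] can be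
    reached from [i]. *)
Lemma irreducible_closed (R : realType) m (P : 'M[R]_m) (C : pred 'I_m) :
    irreducible_mx P -> (forall a b, C a -> ~~ C b -> P a b = 0) ->
  forall i, C i -> forall k, C k.
Proof.
move=> irrP closedC i Ci k; apply: contraT => NCk.
have [n] := irrP i k.
suff P0 : forall l, ~~ C l -> (P ^+ n) i l = 0 by rewrite P0 ?ltxx.
elim: n => [|n IHn] l NCl.
  rewrite expr0 mxE; case: eqVneq => // il.
  by move: NCl; rewrite -il Ci.
rewrite exprSr mxE big1// => a _.
have [Ca|NCa] := boolP (C a); first by rewrite closedC ?mulr0.
by rewrite IHn ?mul0r.
Qed.

Section Stochastic.
Context {R : realType} {m : nat}.
Variable P : 'M[R]_m.
Hypotheses (P0 : forall i j, 0 <= P i j) (P1 : forall i, \sum_j P i j = 1).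
Hypothesis irrP : irreducible_mx P.

(** Minimum principle: at a minimizer the average of [v] cannot exceed the minimum, so every
    successor is a minimizer too. The minimizers thus form a closed set, which irreducibility makes
    everything. *)
Lemma superharmonic_const (v : 'I_m -> R) :
  (forall i, \sum_k P i k * v k <= v i) -> forall i k, v i = v k.
Proof.
move=> supv i.
have [i0 _ min_i0] := @Order.TotalTheory.arg_minP _ _ _ i xpredT v isT.
suff H k : v k == v i0 by move=> k; rewrite (eqP (H i)) (eqP (H k)).
apply: (@irreducible_closed _ _ P (fun k => v k == v i0) irrP _ i0) => //.
move=> a b /eqP va vb.
have : \sum_k P a k * (v k - v i0) <= 0.
  under eq_bigr do rewrite mulrBr.
  by rewrite sumrB -mulr_suml P1 mul1r subr_le0 -va.
have ge0 k' : true -> 0 <= P a k' * (v k' - v i0).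
  by move=> _; rewrite mulr_ge0// subr_ge0 min_i0.
move=> le0; have /eqP : \sum_k P a k * (v k - v i0) = 0.
  by apply/eqP; rewrite eq_le le0 sumr_ge0.
rewrite psumr_eq0// => /allP/(_ b (mem_index_enum b)) /=.
by rewrite mulf_eq0 subr_eq0 (negPf vb) orbF => /eqP.
Qed.

Lemma harmonic_cV (x : 'cV[R]_m) :
  (1%:M - P) *m x = 0 -> exists c, x = c *: ones.
Proof.
move=> /eqP; rewrite mulmxBl mul1mx subr_eq0 => /eqP xP.
have [i _|no_state] := pickP (fun _ : 'I_m => true); last first.
  by exists 0; apply/colP => i; have := no_state i.
exists (x i 0); apply/colP => k; rewrite !mxE mulr1.
apply: (superharmonic_const (v := x^~ 0)) => {}k.
by rewrite /= [in leRHS]xP mxE.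
Qed.

(** * Taboo matrices and the series of their powers *)

Section Taboo.
Variable j : 'I_m.

(** Its [n]-th power holds the probabilities of moving from [i] to [k] in [n] steps while avoiding
    [j] at steps 1 to [n]. Row [j] is kept, so that return times are covered. *)
Definition taboo_mx : 'M[R]_m := \matrix_(i, k) (P i k *+ (k != j)).

Lemma taboo_mx_ge0 i k : 0 <= taboo_mx i k.
Proof. by rewrite mxE mulrn_wge0. Qed.

(** The truncation [min (x, 0)] is superharmonic for [P] itself, because restoring column [j] adds
    only nonpositive terms; the minimum principle then applies to it. *)
Lemma taboo_superharmonic_ge0 (x : 'cV[R]_m) :
  (forall i, (taboo_mx *m x) i 0 <= x i 0) -> forall i, 0 <= x i 0.
Proof.
move=> supx.
pose w i := Num.min (x i 0) 0.
have w_le0 i : w i <= 0 by rewrite ge_min lexx orbT.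
have supw i : \sum_k P i k * w k <= w i.
  rewrite le_min; apply/andP; split; last first.
    by apply: sumr_le0 => k _; rewrite mulr_ge0_le0.
  apply: le_trans (supx i); rewrite mxE; apply: ler_sum => k _; rewrite mxE.
  case: eqVneq => [_|_] /=; first by rewrite mulr0n mul0r mulr_ge0_le0.
  by rewrite mulr1n ler_wpM2l// ge_min lexx.
have w_const := superharmonic_const supw.
move=> i; rewrite leNgt; apply/negP => xi_lt0.
(* If x < 0 somewhere, x is a negative constant, which forces column j of P to
   vanish; then the states other than j would be closed. *)
have wj_lt0 : w j < 0 by rewrite (w_const j i) gt_min xi_lt0.
have xw k : x k 0 = w k.
  by move: wj_lt0; rewrite (w_const j k) /w gt_min ltxx orbF => /ltW/min_idPl.
have colj0 k : P k j = 0.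
  have := supx k; rewrite mxE xw (w_const k j).
  under eq_bigr do rewrite xw (w_const _ j).
  rewrite -mulr_suml => h.
  have : 1 <= \sum_l taboo_mx k l by rewrite -(ler_nM2r wj_lt0) mul1r.
  rewrite -(P1 k) (bigD1 j)//= [leRHS](bigD1 j)//= mxE eqxx mulr0n add0r.
  under [leRHS]eq_bigr => l lj do rewrite mxE lj mulr1n.
  by rewrite gerDr => Pkj; apply/eqP; rewrite eq_le Pkj P0.
(* The closed set [l != j] has to be nonempty: row [j] sums to 1 and its diagonal entry is 0. *)
have [k Pjk] : exists k, P j k != 0.
  apply/existsP; apply: contraT; rewrite negb_exists => /forallP Pj0.
  have := P1 j; rewrite big1 => [|k _]; first by move/eqP; rewrite eq_sym oner_eq0.
  by apply/eqP; rewrite -[_ == _]negbK Pj0.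
have kj : k != j by apply: contraNneq Pjk => ->; rewrite colj0.
suff : j != j by rewrite eqxx.
apply: (irreducible_closed (C := fun l => l != j) irrP _ kj).
by move=> a b _; rewrite negbK => /eqP ->.
Qed.

(** A kernel vector and its opposite are both superharmonic, hence both nonnegative. *)
Lemma sub_taboo_unitmx : 1%:M - taboo_mx \in unitmx.
Proof.
apply: unitmx_trivial_kernel => x /eqP.
rewrite mulmxBl mul1mx subr_eq0 => /eqP xN.
apply/colP => i; apply/eqP; rewrite mxE eq_le; apply/andP; split.
  rewrite -oppr_ge0; have -> : - x i 0 = (- x) i 0 by rewrite mxE.
  by apply: taboo_superharmonic_ge0 => k; rewrite mulmxN -xN.
by apply: taboo_superharmonic_ge0 => k; rewrite -xN.
Qed.

Lemma taboo_mxX_ge0 n i k : 0 <= (taboo_mx ^+ n) i k.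
Proof.
elim: n i k => [|n IHn] i k; first by rewrite expr0 mxE ler0n.
by rewrite exprS mxE sumr_ge0// => l _; rewrite mulr_ge0// taboo_mx_ge0.
Qed.

Lemma series_taboo (x : 'cV[R]_m) i n :
  series (fun k => (taboo_mx ^+ k *m (x - taboo_mx *m x)) i 0) n
  = x i 0 - (taboo_mx ^+ n *m x) i 0.
Proof.
elim: n => [|n IHn]; first by rewrite /series/= big_geq// expr0 mul1mx subrr.
by rewrite seriesSr IHn exprSr mulmxBr !mulmxA !mxE; ring.
Qed.

(** The series of [taboo_mx ^+ n *m ones] has nonnegative terms and partial sums bounded by [h], so
    its terms tend to 0; they dominate the entries of the powers. *)
Lemma taboo_mxX_cvg0 i k : (taboo_mx ^+ n) i k @[n --> \oo] --> 0.
Proof.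
(* [h] is the vector of mean numbers of steps needed to reach [j]. *)
pose h : 'cV[R]_m := invmx (1%:M - taboo_mx) *m ones.
have hE : h - taboo_mx *m h = ones.
  by rewrite -{1}[h]mul1mx -mulmxBl mulKVmx ?sub_taboo_unitmx.
have h_ge0 l : 0 <= h l 0.
  apply: taboo_superharmonic_ge0 => {}l.
  have /matrixP/(_ l 0) := hE.
  by rewrite [LHS]mxE [X in _ + X]mxE [RHS]mxE -subr_ge0 => ->.
have sum_ge0 n : 0 <= (taboo_mx ^+ n *m ones) i 0.
  by rewrite mxE sumr_ge0// => l _; rewrite mulr_ge0 ?taboo_mxX_ge0// mxE.
have cvg_sum : cvgn (series (fun n => (taboo_mx ^+ n *m ones) i 0)).
  apply: nondecreasing_is_cvgn.
    exact: nondecreasing_series.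
  exists (h i 0) => _ [n _ <-]; rewrite -hE series_taboo lerBlDr lerDl mxE.
  by apply: sumr_ge0 => l _; rewrite mulr_ge0 ?taboo_mxX_ge0.
have := cvg_series_cvg_0 cvg_sum.
apply: squeeze_cvgr (@cvg_cst _ _ _ _ _) => //.
apply: nearW => n; rewrite taboo_mxX_ge0 mxE (bigD1 k)//= mxE mulr1 lerDl.
by apply: sumr_ge0 => l _; rewrite mxE mulr1 taboo_mxX_ge0.
Qed.

Lemma taboo_mxX_mul_cvg0 (x : 'cV[R]_m) i :
  (taboo_mx ^+ n *m x) i 0 @[n --> \oo] --> 0.
Proof.
have cvg_terms : \sum_k (taboo_mx ^+ n) i k * x k 0 @[n --> \oo] --> \sum_k 0 * x k 0.
  apply: cvg_big => [|k _]; first exact: add_continuous.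
  apply: cvgM; last exact: cvg_cst.
  exact: taboo_mxX_cvg0.
rewrite big1 in cvg_terms; last by move=> k _; rewrite mul0r.
by under eq_fun do rewrite mxE.
Qed.

Lemma taboo_series_cvg (x y : 'cV[R]_m) i : x - taboo_mx *m x = y ->
  series (fun k => (taboo_mx ^+ k *m y) i 0) @ \oo --> x i 0.
Proof.
move=> <-; rewrite (_ : series _ = fun n => x i 0 - (taboo_mx ^+ n *m x) i 0).
  rewrite -[x i 0 in X in _ --> X]subr0; apply: cvgB; first exact: cvg_cst.
  exact: taboo_mxX_mul_cvg0.
by apply/funext => n; rewrite series_taboo.
Qed.

End Taboo.

(** * Stationary vector and generalized inverses of [I - P] *)

Section StationaryDistribution.
Variable pi : 'cV[R]_m.
Hypotheses (pi_stat : pi^T *m P = pi^T) (pi_sum : pi^T *m ones = 1%:M).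
Local Notation A := (1%:M - P).
Local Notation Pi := (@ones R m *m pi^T).

Lemma laplacian_ones : A *m ones = 0.
Proof.
rewrite mulmxBl mul1mx; apply/colP => i; rewrite !mxE.
under eq_bigr do rewrite mxE mulr1.
by rewrite P1 subrr.
Qed.

Lemma stationary_laplacian : pi^T *m A = 0.
Proof. by rewrite mulmxBr mulmx1 pi_stat subrr. Qed.

Section RankOnePerturbation.
Variable w : 'cV[R]_m.
Hypothesis w_ones : (w^T *m ones) 0 0 != 0.
Local Notation B := (A + ones *m w^T).

(** Applying [pi^T] to [B x = 0] isolates [w^T x = 0]. Then [x] is harmonic, so a multiple of
    [ones], and [w^T ones != 0] makes it zero. The case [w = pi] gives [Z]; a multiple of [u] will
    give the last formula of the theorem. *)
Lemma perturbation_unitmx : B \in unitmx.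
Proof.
apply: unitmx_trivial_kernel => x Bx.
have wx : w^T *m x = 0.
  rewrite -[RHS](mulmx0 _ pi^T) -Bx mulmxA mulmxDr stationary_laplacian add0r.
  by rewrite mulmxA pi_sum mul1mx.
move: Bx; rewrite mulmxDl -mulmxA wx mulmx0 addr0 => /harmonic_cV[c xc].
move: wx; rewrite xc -scalemxAr => /matrixP/(_ 0 0).
rewrite mxE [RHS]mxE => /eqP; rewrite mulf_eq0 (negPf w_ones) orbF => /eqP ->.
by rewrite scale0r.
Qed.

Lemma perturbation_inv_ones :
  invmx B *m ones = ((w^T *m ones) 0 0)^-1 *: ones.
Proof.
apply: (can_inj (mulKmx perturbation_unitmx)).
rewrite mulKVmx ?perturbation_unitmx// -scalemxAr mulmxDl laplacian_ones add0r.
rewrite -mulmxA; have := mx11_scalar (w^T *m ones); set c := _ 0 0 => ->.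
by rewrite mul_mx_scalar scalerA mulVf// scale1r.
Qed.

Lemma perturbation_inv_laplacian :
  invmx B *m A = 1%:M - ((w^T *m ones) 0 0)^-1 *: (ones *m w^T).
Proof.
rewrite -[X in invmx _ *m X](addrK (ones *m w^T)) mulmxBr mulVmx ?perturbation_unitmx//.
by rewrite mulmxA perturbation_inv_ones -scalemxAl.
Qed.

Lemma perturbation_inv_ginv : is_ginv A (invmx B).
Proof.
rewrite /is_ginv -mulmxA perturbation_inv_laplacian mulmxBr mulmx1.
by rewrite -scalemxAr mulmxA laplacian_ones mul0mx scaler0 subr0.
Qed.

End RankOnePerturbation.

Local Notation Z := (invmx (A + Pi)).

Lemma stationary_ones : (pi^T *m ones) 0 0 != 0.
Proof. by rewrite pi_sum mxE oner_eq0. Qed.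

Lemma fundamental_unitmx : A + Pi \in unitmx.
Proof. exact/perturbation_unitmx/stationary_ones. Qed.

Lemma fundamental_ones : Z *m ones = ones.
Proof.
by rewrite perturbation_inv_ones ?stationary_ones// pi_sum mxE invr1 scale1r.
Qed.

Lemma stationary_fundamental : pi^T *m Z = pi^T.
Proof.
apply: (can_inj (mulmxK fundamental_unitmx)).
rewrite mulmxKV ?fundamental_unitmx// mulmxDr stationary_laplacian add0r.
by rewrite mulmxA pi_sum mul1mx.
Qed.

Lemma fundamental_laplacian : Z *m A = 1%:M - Pi.
Proof.
rewrite perturbation_inv_laplacian ?stationary_ones//.
by rewrite pi_sum mxE invr1 scale1r.
Qed.

Lemma laplacian_fundamental : A *m Z = 1%:M - Pi.
Proof.
rewrite -[X in X *m invmx _](addrK Pi) mulmxBl mulmxV ?fundamental_unitmx//.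
by rewrite -mulmxA stationary_fundamental.
Qed.

Lemma mxtrace_ones_stationary (C : 'M[R]_m) :
  \tr (ones *m (pi^T *m C)) = (pi^T *m C *m ones) 0 0.
Proof. by rewrite mxtrace_mulC trace_mx11. Qed.

(** The trace of [G A Z] is computed twice: from [A Z = I - Pi], and from the shape of [G A], which
    differs from [I - Pi] by a term of range spanned by [ones]. *)
Lemma mxtrace_ginv (G : 'M[R]_m) : is_ginv A G ->
  1 + \tr G - \tr (G *m Pi) = \tr Z.
Proof.
move=> AGA.
(* Since [A G A = A], the columns of [G A - I] lie in the kernel of [A], on which [Pi] is the
   identity. *)
have GA : G *m A = 1%:M - Pi + Pi *m (G *m A).
  have : Z *m (A *m (G *m A - 1%:M)) = 0.
    by rewrite mulmxBr mulmxA AGA mulmx1 subrr mulmx0.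
  rewrite (mulmxA Z A) fundamental_laplacian mulmxBl mul1mx => /eqP.
  rewrite subr_eq0 => /eqP GA1.
  rewrite -[LHS](subrK 1%:M) GA1 (mulmxBr Pi (G *m A)) mulmx1.
  by rewrite addrC [X in _ + X]addrC addrA.
have : \tr (G *m (A *m Z)) = \tr Z - 1.
  rewrite mulmxA GA mulmxDl mulmxBl mul1mx mxtraceD raddfB /=.
  rewrite -[Pi *m Z]mulmxA stationary_fundamental.
  have -> : \tr Pi = 1 by rewrite -[pi^T]mulmx1 mxtrace_ones_stationary mulmx1 pi_sum mxE.
  rewrite -!mulmxA mxtrace_ones_stationary -!mulmxA fundamental_ones.
  by rewrite laplacian_ones !mulmx0 mxE addr0.
rewrite laplacian_fundamental mulmxBr mulmx1 raddfB /= => trG.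
by rewrite -addrA trG addrC subrK.
Qed.

Lemma group_inverse_fundamental : is_group_inverse A (Z - Pi).
Proof.
have PiA : Pi *m A = 0 by rewrite -mulmxA stationary_laplacian mulmx0.
have APi : A *m Pi = 0 by rewrite mulmxA laplacian_ones mul0mx.
have AX : A *m (Z - Pi) = 1%:M - Pi by rewrite mulmxBr laplacian_fundamental APi subr0.
have XA : (Z - Pi) *m A = 1%:M - Pi by rewrite mulmxBl fundamental_laplacian PiA subr0.
split; last by rewrite AX XA.
  by rewrite AX mulmxBl mul1mx PiA subr0.
rewrite XA mulmxBl mul1mx mulmxBr.
rewrite -(mulmxA ones) stationary_fundamental mulmxA -(mulmxA ones) pi_sum.
by rewrite mulmx1 subrr subr0.
Qed.

(** Meant for the group inverse, for which the correction [tr (G Pi)] vanishes. *)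
Lemma mxtrace_ginv_killing_ones (G : 'M[R]_m) :
  is_ginv A G -> G *m ones = 0 -> 1 + \tr G = \tr Z.
Proof.
by move=> AGA Gones; rewrite -(mxtrace_ginv AGA) mulmxA Gones mul0mx mxtrace0 subr0.
Qed.

Lemma mxtrace_perturbation_inv (w : 'cV[R]_m) : (w^T *m ones) 0 0 != 0 ->
  1 + \tr (invmx (A + ones *m w^T)) - ((w^T *m ones) 0 0)^-1 = \tr Z.
Proof.
move=> w_ones; rewrite -(mxtrace_ginv (perturbation_inv_ginv w_ones)).
congr (_ - _); rewrite mulmxA perturbation_inv_ones// -scalemxAl mxtraceZ.
by rewrite mxtrace_mulC pi_sum mxtrace_scalar mulr1n mulr1.
Qed.

(** * The matrix of mean first passage times and the trace formula *)

Section FirstPassageMatrix.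
Variables (mu : 'cV[R]_m) (M : 'M[R]_m).
Hypothesis MN : forall j, col j M - taboo_mx j *m col j M = mu.
Local Notation lambda := ((pi^T *m mu) 0 0).
Local Notation D := (diag_mx (\row_j M j j)).

(** Deleting column [j] of [P] has the same effect on [col j M] as deleting its diagonal entry, so
    [taboo_mx j *m col j M] is column [j] of [P (M - D)]. *)
Lemma first_passage_laplacian : A *m (M - D) = mu *m ones^T - D.
Proof.
rewrite mulmxBl mul1mx mulmxBr; apply/matrixP => i j.
have PME : (P *m M) i j = P i j * M j j + \sum_(k | k != j) P i k * M k j.
  by rewrite mxE (bigD1 j).
have PDE : (P *m D) i j = P i j * M j j by rewrite mul_mx_diag !mxE.
have NME : (taboo_mx j *m col j M) i 0 = \sum_(k | k != j) P i k * M k j.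
  rewrite mxE (bigD1 j)//= !mxE eqxx mulr0n mul0r add0r.
  by apply: eq_bigr => k kj; rewrite !mxE kj mulr1n.
have muE : (mu *m ones^T) i j = M i j - \sum_(k | k != j) P i k * M k j.
  by rewrite mxE big_ord1 !mxE mulr1 -(MN j) [LHS]mxE [X in _ + X]mxE NME mxE.
transitivity (M i j - D i j - ((P *m M) i j - (P *m D) i j)); first by rewrite !mxE.
transitivity ((mu *m ones^T) i j - D i j); last by rewrite !mxE.
rewrite PME PDE muE; ring.
Qed.

(** This is Kac's formula [pi_j m_jj = lambda], free of division by [pi_j]. *)
Lemma return_time : D *m pi = lambda *: ones.
Proof.
have : pi^T *m (mu *m ones^T - D) = 0.
  by rewrite -first_passage_laplacian mulmxA stationary_laplacian mul0mx.
rewrite mulmxBr mulmxA => /eqP; rewrite subr_eq0 => /eqP.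
have := mx11_scalar (pi^T *m mu); set l := _ 0 0 => ->.
rewrite mul_scalar_mx => /(congr1 trmx).
by rewrite linearZ /= trmx_mul !trmxK tr_diag_mx => <-.
Qed.

Lemma laplacian_mixed_first_passage : A *m (M *m pi) = mu - lambda *: ones.
Proof.
have : A *m (M *m pi - D *m pi) = mu - D *m pi.
  rewrite -mulmxBl mulmxA first_passage_laplacian mulmxBl -mulmxA.
  rewrite -[ones^T *m pi]trmxK trmx_mul trmxK pi_sum tr_scalar_mx.
  by rewrite mulmx1.
by rewrite return_time mulmxBr -scalemxAr laplacian_ones scaler0 subr0.
Qed.

Lemma kemeny_constant (c : R) : mu = lambda *: ones ->
  M *m pi = c *: ones -> c = lambda * \tr Z.
Proof.
move=> mu_const Mpi.
(* Right multiplication by [dpi] turns [ones^T] into [pi^T] and, by the return time formula, [D]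
   into the scalar [lambda]. *)
pose dpi := diag_mx pi^T.
have onesdpi : ones^T *m dpi = pi^T.
  by apply/rowP => i; rewrite mul_mx_diag !mxE mul1r.
have Ddpi : D *m dpi = lambda%:M.
  have /colP D_pi := return_time; apply/matrixP => i k.
  rewrite mulmx_diag !mxE; case: eqVneq => [->|//]; rewrite !mulr1n.
  by have := D_pi k; rewrite mul_diag_mx !mxE mulr1.
have := congr1 (fun C => \tr (Z *m C *m dpi)) first_passage_laplacian.
rewrite mulmxA fundamental_laplacian mulmxBr !mulmxBl !mul1mx.
move: Ddpi mu_const; set l := (_ *m mu) 0 0 => Ddpi mu_const.
have dpi_ones : dpi *m ones = pi.
  by apply/colP => i; rewrite mul_diag_mx !mxE mulr1.
have trPi : \tr Pi = 1.
  by rewrite -[pi^T]mulmx1 mxtrace_ones_stationary mulmx1 pi_sum mxE.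
(* [M] and [D] share their diagonal, so this trace cancels against that of [D *m dpi]; what remains
   amounts to [l - c = l - l * \tr Z]. *)
have trMdpi : \tr (M *m dpi) = l *+ m.
  rewrite -mxtrace_scalar -Ddpi /mxtrace; apply: eq_bigr => i _.
  by rewrite !mul_mx_diag !mxE eqxx mulr1n.
rewrite -!mulmxA !Ddpi mu_const (mulmxBl _ _ dpi) Ddpi -!scalemxAl -mulmxA.
rewrite onesdpi mulmxBr -scalemxAr (mulmxA Z) fundamental_ones.
rewrite !mul_mx_scalar -scalemxAr !raddfB /= !mxtraceZ mxtrace_scalar.
rewrite mxtrace_ones_stationary trMdpi trPi -!mulmxA dpi_ones Mpi.
rewrite -scalemxAr pi_sum !mxE mulr1n mulr1 => eq_tr.
lra.
Qed.

End FirstPassageMatrix.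
End StationaryDistribution.
End Stochastic.

(** * One step of a Markov renewal process *)

Section FinitePartition.
Context d (T : measurableType d) (R : realType).
Variables (mu : {measure set T -> \bar R}) (m : nat) (Y : T -> 'I_m).
Hypothesis mY : forall j, measurable (Y @^-1` [set j]).
Variables (D : set T) (mD : measurable D).

Lemma ge0_integral_fibers (f : T -> \bar R) :
  measurable_fun D f -> (forall x, D x -> (0 <= f x)%E) ->
  (\int[mu]_(x in D) f x =
   \sum_(j < m) \int[mu]_(x in D `&` Y @^-1` [set j]) f x)%E.
Proof.
move=> mf f0.
have DE : D = \big[setU/set0]_(j < m) (D `&` Y @^-1` [set j]).
  rewrite -big_distrr/=; apply/seteqP; split => [x Dx|x []//]; split => //.
  by rewrite -bigcup_seq; exists (Y x) => //=; rewrite mem_index_enum.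
rewrite [in LHS]DE ge0_integral_bigsetU//= -?DE//.
- by move=> j; exact: measurableI.
- by rewrite index_enum_uniq.
- by move=> i j _ _ [x [[_ /= <-] [_ /= <-]]].
Qed.

Lemma measure_fibers :
  (mu D = \sum_(j < m) mu (D `&` Y @^-1` [set j]))%E.
Proof.
transitivity (\int[mu]_(x in D) (1%E : \bar R))%E.
  by rewrite integral_cst// mul1e.
rewrite ge0_integral_fibers//; apply: eq_bigr => j _.
by rewrite integral_cst ?mul1e//; exact: measurableI.
Qed.

End FinitePartition.

(** Half-open intervals are stable under intersection and generate the Borel sets, and both measures
    are finite on []-k, k]], so they are determined there. The factor [c] will be the mass of a past
    event, possibly 0. *)
Lemma measure_proportional_ocitv (R : realType)
    (f : cumulative R R) (c : {nonneg R})
    (nu : {measure set (measurableTypeR R) -> \bar R}) :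
  (forall a b : R, a <= b -> nu `]a, b]%classic = (c%:num * (f b - f a))%:E) ->
  forall A, measurable A -> nu A = mscale c (lebesgue_stieltjes_measure f) A.
Proof.
move=> nuE A mA; apply/esym.
have scaleE a b : a <= b ->
    mscale c (lebesgue_stieltjes_measure f) `]a, b]%classic = (c%:num * (f b - f a))%:E.
  move=> ab; rewrite /mscale/= /lebesgue_stieltjes_measure/measure_extension.
  rewrite measurable_mu_extE/=; last exact: is_ocitv.
  rewrite wlength_itv_bnd// EFinM EFinB//.
pose lsf : {measure set (measurableTypeR R) -> \bar R} := lebesgue_stieltjes_measure f.
pose m1 : {measure set (measurableTypeR R) -> \bar R} := mscale c lsf.
apply: (@measure_unique _ R (measurableTypeR R) (@ocitv R)
  (fun k : nat => `]- (k%:R : R), k%:R]%classic) _ _ _ _ m1 nu).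
- by [].
- exact: ocitvI.
- by move=> k; exact: is_ocitv.
- exact: (bigcup_itvT false false).
- move=> _ /ocitvP[->|[[a b] /= /ltW ab ->]]; first by rewrite !measure0.
  by rewrite nuE// -scaleE.
- move=> k; have kk : - (k%:R : R) <= k%:R by rewrite ge0_cp.
  by rewrite [ltLHS](scaleE _ _ kk) ltry.
- by [].
Qed.

Section MarkovRenewalStep.
Context {d : measure_display} {Omega : measurableType d} {R : realType}.
Context {m : nat} (p : probability Omega R) (Q : 'I_m -> 'I_m -> cumulative R R).
Context (X : nat -> Omega -> 'I_m) (T : nat -> Omega -> R).
Hypothesis mrp : markov_renewal p Q X T.
Local Notation sojourn n := (fun w => T n.+1 w - T n w).

Lemma history_sub_measurable n : history X T n `<=` measurable.
Proof.
apply: smallest_sub; first exact: sigma_algebra_measurable.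
move=> _ [k _ [[j ->]|[B mB ->]]]; first exact: (mrp_measX mrp).
rewrite -[X in measurable X]setTI; exact: (mrp_measT mrp).
Qed.

Lemma history_mono n n' : (n <= n')%N -> history X T n `<=` history X T n'.
Proof.
move=> nn'; apply: sub_smallest2r; first exact: smallest_sigma_algebra.
by move=> A [k kn Ak]; exists k => //; exact: leq_trans nn'.
Qed.

Lemma history_setT n : history X T n setT.
Proof. exact: (@measurableT _ (g_sigma_algebraType _)). Qed.

Lemma history_setD n A B :
  history X T n A -> history X T n B -> history X T n (A `\` B).
Proof. exact: (@measurableD _ (g_sigma_algebraType _)). Qed.

Lemma history_state n j : history X T n (X n @^-1` [set j]).
Proof. by apply: sub_sigma_algebra; exists n => //; left; exists j. Qed.

(** Step 0 is unconstrained, so that from [j] the first passage is a return. Step [n] is included,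
    which keeps the event in the history up to [n]. *)
Fixpoint taboo_event (j : 'I_m) (n : nat) : set Omega :=
  if n is n'.+1 then taboo_event j n' `\` X n @^-1` [set j] else setT.

Lemma history_taboo j n : history X T n (taboo_event j n).
Proof.
elim: n => [|n IHn] /=; first exact: history_setT.
apply: history_setD; last exact: history_state.
exact: history_mono IHn.
Qed.

Lemma measurable_taboo j n : measurable (taboo_event j n).
Proof. by apply: (@history_sub_measurable n); exact: history_taboo. Qed.

Lemma measurable_sojourn n : measurable_fun setT (sojourn n).
Proof. by apply: measurable_funB; exact: (mrp_measT mrp). Qed.

Lemma sojourn_ge0 n w : 0 <= sojourn n w.
Proof. by rewrite subr_ge0; exact: (mrp_Tle mrp). Qed.

Section Step.
Variables (n : nat) (A : set Omega).
Hypothesis hA : history X T n A.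
Variables i j : 'I_m.

Let mA : measurable A. Proof. exact: (@history_sub_measurable n). Qed.

Let E := A `&` X n @^-1` [set i] `&` X n.+1 @^-1` [set j].

Lemma measurable_step : measurable E.
Proof.
by apply: measurableI; first apply: measurableI => //; exact: (mrp_measX mrp).
Qed.

Let c : R := fine (p (A `&` X n @^-1` [set i])).

Let cE : p (A `&` X n @^-1` [set i]) = c%:E.
Proof.
rewrite fineK// fin_num_measure//; apply: measurableI => //.
exact: (mrp_measX mrp).
Qed.

Let c_ge0 : 0 <= c. Proof. by rewrite fine_ge0. Qed.

Lemma step_le t : p (E `&` sojourn n @^-1` `]-oo, t]) = (c * Q i j t)%:E.
Proof.
rewrite mulrC EFinM -cE -(mrp_markov mrp)//; congr (p _).
apply/seteqP; split=> [w|w []] /=.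
  by rewrite /E/= !in_itv/= => -[[[Aw Xi] Xj] le_t].
by move=> Aw [Xi Xj le_t]; rewrite /E/= !in_itv/=.
Qed.

(** Restricted to [E], the sojourn has as image measure [c] times the Stieltjes measure of [Q i j];
    a change of variables concludes, without dividing by [c]. *)
Lemma integral_step :
  (\int[p]_(w in E) (sojourn n w)%:E = c%:E * mean_transition_time Q i j)%E.
Proof.
pose pE : {measure set Omega -> \bar R} := mrestr p measurable_step.
pose pushE : {measure set (measurableTypeR R) -> \bar R} :=
  pushforward pE (sojourn n : Omega -> measurableTypeR R).
pose nu := pushE (measurable_sojourn n).
rewrite (@eq_measure_integral _ _ _ _ pE); last first.
  by move=> B mB BE; rewrite /= /mrestr setIidl.
pose D : set (measurableTypeR R) := `[0%R, +oo[%classic.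
have mD : measurable D by exact: measurable_itv.
have mid : measurable_fun D (fun t : measurableTypeR R => (t : R)%:E).
  exact/measurable_EFinP/measurable_id.
transitivity (\int[pE]_w (sojourn n w)%:E)%E.
  rewrite [RHS](@ge0_negligible_integral _ _ _ _ _ (~` E))//.
  - by rewrite setTD setCK.
  - exact/measurableC/measurable_step.
  - exact/measurable_EFinP/measurable_sojourn.
  - by move=> w _; rewrite lee_fin sojourn_ge0.
  - by rewrite /= /mrestr setICl measure0.
(* Sojourns are nonnegative, so the preimage of [[0, +oo[] is the whole space. *)
transitivity (\int[nu]_(t in D) (t : R)%:E)%E.
  rewrite /nu /pushE /= ge0_integral_pushforward//; first last.
  - by move=> t; rewrite inE /D/= in_itv/= andbT lee_fin.
  - exact: measurable_sojourn.
  congr (integral _ _ _); apply/seteqP; split=> // w _.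
  by rewrite /D /= in_itv/= andbT sojourn_ge0.
rewrite (@eq_measure_integral _ _ _ _ (mscale (NngNum c_ge0)
   (lebesgue_stieltjes_measure (Q i j)))); last first.
  move=> B mB _; apply: measure_proportional_ocitv => // a b ab.
  have -> : nu `]a, b]%classic =
      p (E `&` sojourn n @^-1` `]-oo, b] `\` (E `&` sojourn n @^-1` `]-oo, a])).
    congr (p _); apply/seteqP; split=> w; rewrite /= !in_itv/=.
      by move=> [/andP[aY Yb] Ew]; split=> // -[_]; rewrite leNgt aY.
    move=> [[Ew Yb] NYa]; split=> //; rewrite Yb andbT ltNge.
    by apply/negP => Ya; exact: NYa.
  have mle t : measurable (E `&` sojourn n @^-1` `]-oo, t]).
    apply: measurableI; first exact: measurable_step.
    by rewrite -[X in measurable X]setTI; exact: measurable_sojourn.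
  have Eab : E `&` sojourn n @^-1` `]-oo, a] `<=` E `&` sojourn n @^-1` `]-oo, b].
    by move=> w []; rewrite /= !in_itv/= => Ew Ya; split=> //; exact: le_trans ab.
  transitivity (p (E `&` sojourn n @^-1` `]-oo, b])
      - p (E `&` sojourn n @^-1` `]-oo, a]))%E.
    rewrite measureD ?(setIidr Eab)//.
    by rewrite -ge0_fin_numE// fin_num_measure.
  by rewrite !step_le -EFinB mulrBr.
rewrite ge0_integral_mscale//.
by move=> t; rewrite /D/= in_itv/= andbT lee_fin.
Qed.

(** Continuity from below along the events where the sojourn is at most [k], which exhaust [E]. *)
Lemma step_cvg (l : R) : Q i j k%:R @[k --> \oo] --> l -> p E = (c * l)%:E.
Proof.
move=> Ql.
pose F k := E `&` sojourn n @^-1` `]-oo, k%:R].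
have EF : E = \bigcup_k F k.
  rewrite -setI_bigcupr; apply/esym/setIidl => w _.
  exists (Num.truncn (sojourn n w)).+1 => //=.
  by rewrite in_itv/= ltW// truncnS_gt.
have mF k : measurable (F k).
  apply: measurableI; first exact: measurable_step.
  by rewrite -[X in measurable X]setTI; exact: measurable_sojourn.
have : p \o F @ \oo --> p (\bigcup_k F k).
  apply: nondecreasing_cvg_mu => //; first exact: bigcupT_measurable.
  move=> k k' kk'; apply/subsetPset => w [Ew]; rewrite /= !in_itv/= => Yk.
  by split=> //=; rewrite in_itv/= (le_trans Yk)// ler_nat.
rewrite -EF => pF; apply: cvg_unique pF _ => //.
rewrite (_ : p \o F = EFin \o (fun k => c * Q i j k%:R)).
  by apply: cvg_EFin; [exact: nearW|apply: cvgMr].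
by apply/funext => k /=; rewrite step_le.
Qed.
End Step.

(** * First passage times as series of sojourn times *)

Lemma taboo_eventP j n w :
  taboo_event j n w <-> forall r, (0 < r <= n)%N -> X r w <> j.
Proof.
elim: n => [|n [IHn IHn']] /=.
  by split=> // _ r /andP[r0 rn]; move: (leq_trans r0 rn).
split=> [[/IHn Xr Xn] r /andP[r0]|Xr].
  by rewrite leq_eqVlt => /orP[/eqP ->//|rn]; apply: Xr; rewrite r0.
split; last by apply: Xr; rewrite ltnSn.
by apply: IHn' => r /andP[r0 rn]; apply: Xr; rewrite r0 leqW.
Qed.

(* The last term accounts for paths that never visit [j], on which the series
   is only the limit of [T n], possibly finite. *)
Lemma first_passage_time_series j w :
  first_passage_time X T j w =
  (\sum_(n <oo) ((fun w => (sojourn n w)%:E) \_ (taboo_event j n)) w +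
   ((cst +oo) \_ (\bigcap_n taboo_event j n)) w)%E.
Proof.
have term_ge0 n : (0 <= ((fun w => (sojourn n w)%:E) \_ (taboo_event j n)) w)%E.
  by rewrite patchE; case: ifPn => // _; rewrite lee_fin sojourn_ge0.
rewrite /first_passage_time; case: pselect => [ex_r|no_r]; last first.
  rewrite [X in (_ + X)%E]patchE mem_set ?addey//.
    by rewrite gt_eqF// (lt_le_trans (ltNyr 0))// nneseries_ge0.
  move=> n _; apply/taboo_eventP => r /andP[r0 _] Xr.
  by apply: no_r; exists r; rewrite r0 Xr eqxx.
case: ex_minnP => r /andP[r0 /eqP Xr] min_r.
rewrite [X in (_ + X)%E]patchE memNset ?adde0; last first.
  by move=> /(_ r I)/taboo_eventP/(_ r); apply=> //; rewrite r0 leqnn.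
(* Sojourn [n] counts when [j] is avoided at steps 1 to [n], that is for [n < r]: these terms
   telescope to [T r - T 0], and the later ones vanish. *)
rewrite (nneseries_split 0 r)// [X in (_ + X)%E]eseries0 ?adde0; last first.
  move=> n rn _; rewrite patchE memNset//.
  by move=> /taboo_eventP/(_ r); apply=> //; rewrite r0.
rewrite add0n (eq_big_nat _ _ (F2 := fun n => (T n.+1 w - T n w)%:E)) => [|n /andP[_ nr]].
  by rewrite sumEFin telescope_sumr// (mrp_T0 mrp) subr0.
rewrite patchE mem_set//; apply/taboo_eventP => k /andP[k0 kn] Xk.
by have := min_r k; rewrite k0 Xk eqxx leqNgt (leq_ltn_trans kn nr) => /(_ isT).
Qed.

Lemma integral_first_passage_time j :
  p (\bigcap_n taboo_event j n) = 0%E ->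
  (\int[p]_w first_passage_time X T j w =
   \sum_(n <oo) \int[p]_(w in taboo_event j n) (sojourn n w)%:E)%E.
Proof.
move=> never0.
have mterm n : measurable_fun setT
    ((fun w => (sojourn n w)%:E) \_ (taboo_event j n)).
  apply/(measurable_restrictT _ (measurable_taboo j n)).
  exact/measurable_EFinP/measurable_funTS/measurable_sojourn.
have term_ge0 n w : (0 <= ((fun w => (sojourn n w)%:E) \_ (taboo_event j n)) w)%E.
  by rewrite patchE; case: ifPn => // _; rewrite lee_fin sojourn_ge0.
have mnever : measurable (\bigcap_n taboo_event j n).
  by apply: bigcapT_measurable => n; exact: measurable_taboo.
under eq_integral do rewrite first_passage_time_series.
rewrite ge0_integralD//; last 4 first.
- by move=> w _; exact: nneseries_ge0.
- exact: ge0_emeasurable_sum.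
- by move=> w _; rewrite patchE; case: ifPn => _ /=; rewrite ?leey.
- exact/(measurable_restrictT _ mnever).
rewrite -integral_mkcond integral_cst// [X in (+oo * X)%E]never0 mule0 adde0.
rewrite integral_nneseries//; apply: eq_eseriesr => n _.
by rewrite -integral_mkcond.
Qed.

End MarkovRenewalStep.

(** * Mean first passage times *)

Section MeanFirstPassage.
Context {d : measure_display} {Omega : measurableType d} {R : realType} {m : nat}.
Context (Pr : 'I_m -> probability Omega R) (Q : 'I_m -> 'I_m -> cumulative R R).
Context (X : nat -> Omega -> 'I_m) (T : nat -> Omega -> R).
Hypothesis hMRP : mrp_family Pr Q X T.
Local Notation P := (embedded_mx Q).

Let mrp i : markov_renewal (Pr i) Q X T. Proof. by have [] := hMRP i. Qed.

Let start i : Pr i (X 0%N @^-1` [set i]) = 1%E.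
Proof. by have [] := hMRP i. Qed.

Let hist0 : history X T 0 setT. Proof. exact: history_setT. Qed.

Lemma kernel_prob i j t :
  Pr i (setT `&` X 0%N @^-1` [set i] `&` X 1%N @^-1` [set j]
    `&` (fun w => T 1%N w - T 0%N w) @^-1` `]-oo, t]) = (Q i j t)%:E.
Proof.
by rewrite (step_le (mrp i) hist0) setTI start mul1r.
Qed.

(** The [lim] defining [embedded_mx] is a true limit: [Q i j] is monotone, and bounded by 1 because
    its values are probabilities under [Pr i]. *)
Lemma kernel_cvg i j : Q i j k%:R @[k --> \oo] --> P i j.
Proof.
have nd : nondecreasing_fun (Q i j).
  by move=> x y; exact: cumulative_is_nondecreasing.
have ub : has_ubound (range (Q i j)).
  exists 1 => _ [t _ <-]; rewrite -lee_fin -kernel_prob; apply: probability_le1.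
  apply: measurableI; first exact: (measurable_step (mrp i) hist0).
  rewrite -[X in measurable X]setTI; exact: (measurable_sojourn (mrp i)).
have Qcvg := nondecreasing_cvgr nd ub.
rewrite mxE (cvg_lim _ Qcvg)//.
exact: (cvg_comp _ _ (@cvgr_idn R) Qcvg).
Qed.

Lemma step_prob i0 n A i j : history X T n A ->
  Pr i0 (A `&` X n @^-1` [set i] `&` X n.+1 @^-1` [set j])
  = (fine (Pr i0 (A `&` X n @^-1` [set i])) * P i j)%:E.
Proof. by move=> hA; apply: (step_cvg (mrp i0) hA); exact: kernel_cvg. Qed.

Lemma embedded_mx_ge0 i j : 0 <= P i j.
Proof.
have := step_prob i i j hist0.
by rewrite setTI start mul1r -lee_fin => <-.
Qed.

Lemma embedded_mx_sum1 i : \sum_j P i j = 1.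
Proof.
apply: EFin_inj; rewrite -sumEFin -(start i).
rewrite (measure_fibers _ (mrp_measX (mrp i) 1)); last exact: mrp_measX (mrp i) _ _.
apply: eq_bigr => j _.
have := step_prob i i j hist0.
by rewrite setTI start mul1r => /esym.
Qed.

Section Target.
Variable j : 'I_m.
Local Notation N := (taboo_mx P j).

(** Induction on [n], splitting on the state at step [n]; the Markov property applies because the
    taboo event belongs to the history. For [k = j] both sides vanish. *)
Lemma taboo_event_prob i n k :
  Pr i (taboo_event X j n `&` X n @^-1` [set k]) = ((N ^+ n) i k)%:E.
Proof.
elim: n k => [|n IHn] k /=.
  rewrite setTI expr0 mxE; case: eqVneq => [->|ik]; first exact: start.
  apply/eqP; rewrite eq_le measure_ge0 andbT.
  rewrite -[leRHS](_ : Pr i (~` (X 0%N @^-1` [set i])) = _)%E; last first.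
    rewrite probability_setC ?start ?subee//; exact: mrp_measX (mrp i) _ _.
  apply: le_measure; rewrite ?inE; [exact: mrp_measX (mrp i) _ _| |].
    apply: measurableC; exact: mrp_measX (mrp i) _ _.
  by move=> w /= ->; apply/eqP; rewrite eq_sym.
rewrite exprSr mxE; have [->|kj] := eqVneq k j.
  rewrite big1 => [|l _]; last by rewrite mxE eqxx mulr0n mulr0.
  rewrite (_ : _ `&` _ = set0) ?measure0//.
  by apply/seteqP; split=> // w [[_ NXj] /NXj].
rewrite (_ : _ `&` _ = taboo_event X j n `&` X n.+1 @^-1` [set k]); last first.
  apply/seteqP; split=> w [] /=; first by move=> [].
  by move=> tabooj ->; split=> //; split=> //; exact/eqP.
rewrite (measure_fibers _ (mrp_measX (mrp i) n)); last first.
  apply: measurableI; first exact: (measurable_taboo (mrp i)).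
  exact: mrp_measX (mrp i) _ _.
rewrite -sumEFin; apply: eq_bigr => l _; rewrite setIAC.
apply: etrans (step_prob i l k (@history_taboo _ _ _ _ X T j n)) _.
by rewrite IHn [N l k]mxE kj mulr1n.
Qed.

Lemma taboo_event_probT i n :
  Pr i (taboo_event X j n) = ((N ^+ n *m ones) i 0)%:E.
Proof.
rewrite (measure_fibers _ (mrp_measX (mrp i) n)); last first.
  exact: (measurable_taboo (mrp i)).
rewrite mxE -sumEFin; apply: eq_bigr => k _; rewrite mxE mulr1.
exact: taboo_event_prob.
Qed.

(** The event lies in every [taboo_event X j n], and these have probabilities tending to 0. *)
Lemma never_visited_prob0 i : irreducible_mx P ->
  Pr i (\bigcap_n taboo_event X j n) = 0%E.
Proof.
move=> irrP; apply/eqP; rewrite eq_le measure_ge0 andbT.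
have cvg0 : ((N ^+ n *m ones) i 0)%:E @[n --> \oo] --> (0 : R)%:E.
  apply: cvg_EFin; first exact: nearW.
  exact: taboo_mxX_mul_cvg0 embedded_mx_ge0 embedded_mx_sum1 irrP _ _ _.
apply: (cvge_ge _ cvg0).
apply: nearW => n; rewrite -taboo_event_probT; apply: le_measure; rewrite ?inE.
- by apply: bigcapT_measurable => k; exact: (measurable_taboo (mrp i)).
- exact: (measurable_taboo (mrp i)).
- by move=> w; apply.
Qed.

Hypothesis mean_fin : forall i k, mean_transition_time Q i k \is a fin_num.

(** Splitting on the states before and after the step gives products of a taboo probability and a
    mean transition time; summing over the target state produces [mean_sojourn]. *)
Lemma taboo_event_sojourn i n :
  (\int[Pr i]_(w in taboo_event X j n) (T n.+1 w - T n w)%:E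
   = ((N ^+ n *m mean_sojourn Q) i 0)%:E)%E.
Proof.
have msoj D : measurable_fun D (fun w => (T n.+1 w - T n w)%:E).
  exact/measurable_EFinP/measurable_funTS/(measurable_sojourn (mrp i)).
have soj0 w : (0 <= (T n.+1 w - T n w)%:E)%E.
  by rewrite lee_fin (sojourn_ge0 (mrp i)).
have mtaboo := measurable_taboo (mrp i) j n.
have mX k l : measurable (X k @^-1` [set l]) by exact: mrp_measX (mrp i) k l.
rewrite (ge0_integral_fibers _ (mX n))// mxE -sumEFin; apply: eq_bigr => k _.
rewrite (ge0_integral_fibers _ (mX n.+1))//; last exact: measurableI.
rewrite mxE mulr_sumr -sumEFin; apply: eq_bigr => l _.
apply: etrans (integral_step (mrp i) (@history_taboo _ _ _ _ X T j n) k l) _.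
by rewrite taboo_event_prob/= EFinM fineK.
Qed.

(** The mean is the series of [N ^+ n *m mean_sojourn Q], which the one-step equation sums to [x];
    in particular it is finite. *)
Lemma mean_first_passageE i (x : 'cV[R]_m) : irreducible_mx P ->
  x - N *m x = mean_sojourn Q -> mean_first_passage Pr X T i j = (x i 0)%:E.
Proof.
move=> irrP xE; rewrite /mean_first_passage.
rewrite (integral_first_passage_time (mrp i)) ?never_visited_prob0//.
under eq_eseriesr do rewrite taboo_event_sojourn.
apply/cvg_lim => //.
under eq_fun do rewrite sumEFin.
apply: cvg_EFin; first exact: nearW.
exact: taboo_series_cvg embedded_mx_ge0 embedded_mx_sum1 irrP _ _ _ _ xE.
Qed.

End Target.
End MeanFirstPassage.

(** * Constancy of the mixture and the expressions of its value *)

Theorem corollary1p1 (R : realType) (d : measure_display)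
    (Omega : measurableType d) (m : nat)
    (Pr : 'I_m -> probability Omega R)
    (Q : 'I_m -> 'I_m -> cumulative R R)
    (X : nat -> Omega -> 'I_m) (T : nat -> Omega -> R)
    (P : 'M[R]_m) (mu pi : 'cV[R]_m) (lambda : R) (k1 : 'I_m -> \bar R)
    (hMRP : mrp_family Pr Q X T)
    (hP : P = embedded_mx Q)
    (hirr : irreducible_mx P)
    (hfin : forall i j, mean_transition_time Q i j \is a fin_num)
    (hmu : mu = mean_sojourn Q)
    (hpi_stat : pi^T *m P = pi^T)
    (hpi_sum : pi^T *m ones = 1%:M)
    (hlambda : lambda = (pi^T *m mu) 0 0)
    (hlambda_gt0 : 0 < lambda)
    (hk1 : k1 = mixed_first_passage Pr X T pi) :
  ((forall i i' : 'I_m, k1 i = k1 i') <->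
   (forall j j' : 'I_m, mu j 0 = mu j' 0))
  /\
  ((forall j j' : 'I_m, mu j 0 = mu j' 0) ->
   mu = lambda *: ones /\
   exists KC : R,
     [/\ (forall i : 'I_m, k1 i = KC%:E),
         (forall G : 'M[R]_m, is_ginv (1%:M - P) G ->
            KC = lambda * (1 + \tr G - \tr (G *m (ones *m pi^T)))),
         (1%:M - P + ones *m pi^T \in unitmx /\
          KC = lambda * \tr (invmx (1%:M - P + ones *m pi^T))),
         ((exists! Ash : 'M[R]_m, is_group_inverse (1%:M - P) Ash) /\
          forall Ash : 'M[R]_m, is_group_inverse (1%:M - P) Ash ->
            KC = lambda * (1 + \tr Ash)) &
         (forall u : 'cV[R]_m, (u^T *m ones) 0 0 != 0 ->
            1%:M - P + mu *m u^T \in unitmx /\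
            KC = lambda * (1 + \tr (invmx (1%:M - P + mu *m u^T)))
                 - 1 / (u^T *m ones) 0 0)]).
Proof.
have P0 i j : 0 <= P i j by rewrite hP; exact: embedded_mx_ge0 hMRP i j.
have P1 i : \sum_j P i j = 1 by rewrite hP; exact: embedded_mx_sum1 hMRP i.
(* [M] is built algebraically, by solving the one-step equations column by column; [k1E] then ties
   it to the actual mean first passage times. *)
pose M : 'M[R]_m := \matrix_(i, j) (invmx (1%:M - taboo_mx P j) *m mu) i 0.
have colM j : col j M = invmx (1%:M - taboo_mx P j) *m mu.
  by apply/colP => i; rewrite !mxE.
have MN j : col j M - taboo_mx P j *m col j M = mu.
  rewrite colM -[X in X - _]mul1mx -mulmxBl mulKVmx//.
  exact: sub_taboo_unitmx.
have k1E i : k1 i = ((M *m pi) i 0)%:E.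
  rewrite hk1 /mixed_first_passage mxE -sumEFin; apply: eq_bigr => j _.
  rewrite (mean_first_passageE hMRP hfin i (x := col j M)) -?hP -?hmu//.
  by rewrite mxE -EFinM mulrC.
have lapk := laplacian_mixed_first_passage P1 hpi_stat hpi_sum MN.
have kconst := kemeny_constant P0 P1 hirr hpi_stat hpi_sum MN.
rewrite -hlambda in lapk kconst.
have mu_lambda : (forall j j', mu j 0 = mu j' 0) -> mu = lambda *: ones.
  move=> mu_const; have [j0 _|no_state] := pickP (fun _ : 'I_m => true).
    have muE : mu = mu j0 0 *: ones.
      by apply/colP => j; rewrite !mxE mulr1.
    rewrite hlambda [in RHS]muE -scalemxAr hpi_sum !mxE mulr1.
    exact: muE.
  by apply/colP => j; have := no_state j.
have k_const : mu = lambda *: ones -> exists c, M *m pi = c *: ones.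
  by move=> muE; apply: (harmonic_cV P0 P1 hirr); rewrite lapk muE subrr.
have lambda_neq0 : lambda != 0 by rewrite gt_eqF.
split.
  split=> [k_eq|/mu_lambda/k_const[c Mpi] i i']; last first.
    by rewrite !k1E Mpi !mxE.
  have [c Mpi] : exists c, M *m pi = c *: ones.
    have [i0 _|no_state] := pickP (fun _ : 'I_m => true); last first.
      by exists 0; apply/colP => i; have := no_state i.
    exists ((M *m pi) i0 0); apply/colP => i.
    by apply: EFin_inj; rewrite -k1E (k_eq i i0) k1E !mxE mulr1.
  have : mu - lambda *: ones = 0.
    by rewrite -lapk Mpi -scalemxAr laplacian_ones// scaler0.
  by move/eqP; rewrite subr_eq0 => /eqP -> j j'; rewrite !mxE.
move=> /mu_lambda muE; split=> //.
have [c Mpi] := k_const muE; exists c.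
have cE := kconst c muE Mpi.
split.
- by move=> i; rewrite k1E Mpi !mxE mulr1.
- by move=> G AGA; rewrite (mxtrace_ginv P0 P1 hirr hpi_stat hpi_sum AGA).
- by split=> //; exact: fundamental_unitmx.
- split=> [|Ash [AGA AGGA comm]].
    exists (invmx (1%:M - P + ones *m pi^T) - ones *m pi^T).
    have Ash := group_inverse_fundamental P0 P1 hirr hpi_stat hpi_sum.
    by split=> // Y; exact: group_inverse_unique.
  rewrite (mxtrace_ginv_killing_ones P0 P1 hirr hpi_stat hpi_sum AGA)//.
  (* The group inverse kills [ones], since [Ash = Ash A Ash = Ash Ash A]. *)
  by rewrite -AGGA -(mulmxA Ash) comm -!mulmxA laplacian_ones ?mulmx0.
(* As [mu = lambda *: ones], the perturbation [mu u^T] equals [ones w^T], and [lambda / (w^T ones)]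
   reduces to [1 / (u^T ones)]. *)
- move=> u u_ones; pose w := lambda *: u.
  have muw : mu *m u^T = ones *m w^T.
    by rewrite muE -scalemxAl linearZ -scalemxAr.
  have wE : (w^T *m ones) 0 0 = lambda * (u^T *m ones) 0 0.
    by rewrite linearZ -scalemxAl mxE.
  have w_ones : (w^T *m ones) 0 0 != 0 by rewrite wE mulf_neq0.
  rewrite muw; split; first exact: (perturbation_unitmx P0 P1 hirr hpi_stat hpi_sum).
  rewrite cE -(mxtrace_perturbation_inv P0 P1 hirr hpi_stat hpi_sum w_ones) wE.
  by field; rewrite lambda_neq0 u_ones.
Qed.
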